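(* Let $m\ge4$ be even. Let $\Omega$ be a finite set (of columns), and let $(A_B)_{B\in\mathcal B}$ be a finite indexed family of subsets of $\Omega$ with $|A_B|\ge2$ for every $B$; put $b_B=\lfloor |A_B|/2\rfloor$. Let $\Omega_{\mathrm{dist}}\subseteq\Omega$ be a set of distinguished columns satisfying $|A_B\cap\Omega_{\mathrm{dist}}|\le1$ for every $B\in\mathcal B$. The following are equivalent. (i) Each connected component of the incidence graph contains an even number of column vertices. (ii) One can choose sets $J_{B,t}\subseteq A_B$ for $B\in\mathcal B$, $t\in\mathbb Z_m$, with $|J_{B,t}|=b_B$, such that: (1) for every column $\lambda\in\Omega$ the total $\sum_{B\in\mathcal B}\sum_{t\in\mathbb Z_m}\mathbf 1_{\{\lambda\in J_{B,t}\}}$ is congruent to $1$ or $-1$ modulo $m$; (2) no distinguished column belongs to $J_{B,0}$, for any $B$; (3) for each $B$, the family $\{J_{B,t}:t\in\mathbb Z_m\}$ is intersection-connected whenever its members have size at least two, and the family $\{A_B\setminus J_{B,t}:t\in\mathbb Z_m\}$ is intersection-connected whenever its members have size at least two.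
   Context: The incidence graph is the bipartite graph with vertex classes $\mathcal B$ (block vertices) and $\Omega$ (column vertices), with an edge $B\lambda$ exactly when $\lambda\in A_B$. All columns are included; a column in no support is an isolated vertex (forming a component with one column vertex). The family is indexed, so equal supports may occur for different $B$. A family of nonempty sets is intersection-connected if its intersection graph (vertices are the members, two members adjacent when they intersect) is connected. $\mathbb Z_m=\mathbb Z/m\mathbb Z$. *)

(* Defs.v *)
From mathcomp Require Import all_boot all_algebra.

Set Implicit Arguments.
Unset Strict Implicit.
Unset Printing Implicit Defensive.

Definition incidence_rel (Block Omega : finType) (A : Block -> {set Omega}) :
    rel (Block + Omega) :=
  fun u v => match u, v with
             | inl B, inr l => l \in A B
             | inr l, inl B => l \in A B
             | _, _ => false
             end.

Definition components (V : finType) (e : rel V) : {set {set V}} :=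
  equivalence_partition (connect e) [set: V].

Definition columns (Block Omega : finType) (C : {set Block + Omega}) :
    {set Omega} :=
  [set l | inr l \in C].

(* Vertices are the indices rather than the distinct members: for nonempty
   members, two indices carrying the same set are adjacent, so repetitions do
   not affect connectedness. *)
Definition intersection_rel (T Omega : finType) (F : T -> {set Omega}) :
    rel T :=
  fun s t => (s != t) && (F s :&: F t != set0).

Definition intersection_connected (T Omega : finType)
    (F : T -> {set Omega}) : Prop :=
  forall s t : T, connect (intersection_rel F) s t.

(* Main.v *)
Require Import Defs.
From mathcomp Require Import all_boot all_algebra.
From mathcomp Require Import zify.

(** Suppose first that the sets [J B t] are given.  Each column total is
    congruent to 1 or -1 modulo the even number [m], hence odd, so a component
    has as many columns, modulo 2, as the sum of its column totals.  Counted
    block by block, that sum consists of [m] sets of a common size for each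
    block, so it is even ([component_even]).

    Conversely, suppose that every component has evenly many columns.  Joining
    each column by a path to the root of its component, and adding these paths
    modulo 2, gives a set of edges that meets every column an odd number of
    times and every block an even number of times: the parity accumulated at a
    root is that of the number of columns of its component ([odd_join]).  In any
    bipartite graph the edges can be signed so that the positive and negative
    edges at each vertex differ in number by at most one
    ([balanced_colouring]); for the edges just found, the signs balance at each
    block and sum to 1 or -1 at each column ([signed_join]).

    It remains to realise the signs inside one block, with as many positive as
    negative columns ([block_selection]).  A positive column is put in exactly
    one of the [m] sets, a negative column in all but one, and an unsigned
    column in all or none, which gives it the required total modulo [m].  Each
    signed column thus has one exceptional index.  If every index is exceptional
    for as many positive as negative columns, all [m] sets have the same size,
    and half of the unsigned columns, rounded down, go in all sets to make that
    size right.
    Exceptional indices are only ever [t0 = 0] or another index [t1], so any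
    third index [t2] is ordinary: its set contains all the negative columns and
    meets every other one, unless the latter omits all the negative columns at
    once.  Using both values [t0] and [t1] prevents this.  Complements behave in
    the same way, as they swap the two signs and the two kinds of unsigned
    columns.  The freedom left suffices to keep the single distinguished column
    of the block out of the set at index [t0]: it receives the exceptional index
    [t1] if positive and [t0] if negative, and is put in no set if unsigned. *)

Set Implicit Arguments.
Unset Strict Implicit.
Unset Printing Implicit Defensive.

(** * Balanced two-colourings *)

(** Joining each [e] to [p e] and [q e] gives a graph whose components are even
    cycles, which are bipartite.  Along a cycle every second element is reached
    by iterating [r = q \o p]; since [p] conjugates [r] to its inverse, a common
    orbit of [e] and [p e] would contain a fixed point of [p] or [q].  So the
    orbits of [r] come in pairs exchanged by both [p] and [q], and comparing the
    ranks of the two orbits of a pair tells them apart. *)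
Lemma colour_derangements (E : finType) (p q : E -> E) :
    involutive p -> involutive q ->
    (forall e, p e != e) -> (forall e, q e != e) ->
  exists sigma : pred E,
    forall e, sigma (p e) = ~~ sigma e /\ sigma (q e) = ~~ sigma e.
Proof.
move=> pK qK p_moves q_moves; pose r e := q (p e).
have r_inj : injective r by apply: inj_comp; exact: can_inj.
(* Two steps of [r] fewer, starting from [r e]: the midpoint of the arc from [e]
   to [p e] is kept, until one step or none remains. *)
have iter_r_neq k : forall e, p e != iter k r e.
  elim/ltn_ind: k => -[|[|k]] IHk e; first exact: p_moves.
    by rewrite eq_sym; apply: q_moves.
  have /eqP := IHk k (ltnW (ltnSn _)) (r e); apply: contra_not_neq.
  by rewrite iterS iterSr => pe; rewrite {1}/r pe {1}/r qK pK.
have root_eq x y : fconnect r x y -> froot r x = froot r y.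
  by move/(fingraph.rootP (fconnect_sym r_inj)).
have root_p e : froot r (p e) != froot r e.
  rewrite (root_connect (fconnect_sym r_inj)) fconnect_sym //.
  by apply/negP => /iter_findex def_pe; case/eqP: (iter_r_neq (findex r e (p e)) e).
exists (fun e => enum_rank (froot r e) < enum_rank (froot r (p e))) => e.
have ->: froot r (q e) = froot r (p e).
  by apply/esym/root_eq; rewrite -{2}[e]pK fconnect1.
have ->: froot r (p (q e)) = froot r e.
  by apply: root_eq; rewrite -{2}[e]qK -{2}[q e]pK fconnect1.
have: val (enum_rank (froot r (p e))) != enum_rank (froot r e).
  by rewrite (inj_eq val_inj) (inj_eq enum_rank_inj).
by rewrite pK /=; case: ltngtP.
Qed.

(** Fixed points are removed by taking two copies of [E] and matching each fixed
    point with its other copy. *)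
Lemma colour_involutions (E : finType) (p q : E -> E) :
    involutive p -> involutive q ->
  exists sigma : pred E, forall e,
    (p e != e -> sigma (p e) = ~~ sigma e) /\
    (q e != e -> sigma (q e) = ~~ sigma e).
Proof.
move=> pK qK.
pose double (f : E -> E) (u : E * bool) : E * bool :=
  if f u.1 == u.1 then (u.1, ~~ u.2) else (f u.1, u.2).
have doubleK f : involutive f -> involutive (double f).
  move=> fK [e b]; rewrite /double /=; case: (eqVneq (f e) e) => [fe | fe] /=.
    by rewrite fe eqxx negbK.
  by rewrite fK eq_sym (negPf fe).
have double_moves f u : double f u != u.
  rewrite /double; case: (eqVneq (f u.1) u.1) => fu; rewrite -pair_eqE /=.
    by rewrite eqxx; case: u.2.
  by rewrite (negPf fu).
have [sigma sigmaP] := colour_derangements (doubleK _ pK) (doubleK _ qK)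
  (double_moves p) (double_moves q).
exists (fun e => sigma (e, true)) => e; have := sigmaP (e, true).
by rewrite /double /=; case: eqP; case: eqP => //= _ _ [].
Qed.

(** The involution of the indices below [n] that exchanges 2j and 2j+1; the last
    index is left alone when [n] is odd. *)
Definition mate (n i : nat) : nat :=
  if odd i then i.-1 else if i.+1 < n then i.+1 else i.

Lemma mate_lt n i : i < n -> mate n i < n.
Proof. by rewrite /mate => lt_i; case: ifP => // _; [lia | case: ifP]. Qed.

Lemma mateK n i : i < n -> mate n (mate n i) = i.
Proof. by rewrite /mate => lt_i; repeat case: ifP; lia. Qed.

Lemma mate_fixed n i : i < n -> mate n i = i -> i = n.-1.
Proof. by rewrite /mate => lt_i; repeat case: ifP; lia. Qed.

(** Positions in an enumeration of each fibre are paired off. *)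
Lemma fibre_pairing (E : finType) (X : eqType) (f : E -> X) :
  exists p : E -> E,
    [/\ involutive p, forall e, f (p e) = f e
      & forall e e', f e = f e' -> p e = e -> p e' = e' -> e = e'].
Proof.
pose K x := enum [pred e | f e == x].
have inK e : e \in K (f e) by rewrite mem_enum inE.
pose p e := nth e (K (f e)) (mate (size (K (f e))) (index e (K (f e)))).
have index_lt e : index e (K (f e)) < size (K (f e)) by rewrite index_mem.
have fp e : f (p e) = f e.
  by have := mem_nth e (mate_lt (index_lt e)); rewrite mem_enum inE => /eqP.
have index_p e : index (p e) (K (f e)) = mate (size (K (f e))) (index e (K (f e))).
  by rewrite index_uniq ?enum_uniq ?mate_lt.
exists p; split => // [e | e e' fe pe pe'].
  by rewrite {1}/p fp index_p mateK // nth_index.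
have last_of_fixed x : p x = x -> index x (K (f x)) = (size (K (f x))).-1.
  by move=> px; apply: mate_fixed => //; rewrite -index_p px.
rewrite -[e](nth_index e (inK e)) -[e'](nth_index e (inK e')).
by rewrite !last_of_fixed // fe.
Qed.

(** The pairing exchanges the two colours in each fibre, except at its only
    possible fixed point. *)
Lemma balanced_of_pairing (E : finType) (X : eqType) (f : E -> X) (p : E -> E)
    (sigma : pred E) :
    involutive p -> (forall e, f (p e) = f e) ->
    (forall e e', f e = f e' -> p e = e -> p e' = e' -> e = e') ->
    (forall e, p e != e -> sigma (p e) = ~~ sigma e) ->
  forall x,
    let a := #|[set e | f e == x & sigma e]| in
    let b := #|[set e | f e == x & ~~ sigma e]| in a <= b.+1 /\ b <= a.+1.
Proof.
move=> pK fp p_fix sigma_p x a b.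
have card_le (tau : pred E) : (forall e, p e != e -> tau (p e) = ~~ tau e) ->
    #|[set e | f e == x & tau e]| <= #|[set e | f e == x & ~~ tau e]|.+1.
  move=> tau_p; set S := [set e | _].
  rewrite -(cardsID [set e | p e == e] S) -add1n leq_add //; last first.
    rewrite -(card_imset _ (can_inj pK)); apply/subset_leq_card/subsetP => e'.
    case/imsetP => e; rewrite !inE => /and3P[pe fe te] ->.
    by rewrite fp fe tau_p // te.
  apply/card_le1_eqP => e e'; rewrite !inE.
  move=> /andP[/andP[/eqP fe _] /eqP pe] /andP[/andP[/eqP fe' _] /eqP pe'].
  by apply: p_fix; rewrite ?fe.
split; first exact: card_le.
apply: leq_trans (card_le (predC sigma) _) _ => [e /sigma_p /= -> // |].
rewrite ltnS; apply/subset_leq_card/subsetP => e.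
by rewrite !inE /= negbK.
Qed.

(** When [E] is the edge set of a bipartite graph and [f], [g] give the two ends of
    an edge, this is the splitting of the edges into two classes that are as equal
    as possible at every vertex. *)
Lemma balanced_colouring (E : finType) (X Y : eqType) (f : E -> X) (g : E -> Y) :
  exists sigma : pred E,
    (forall x, let a := #|[set e | f e == x & sigma e]| in
               let b := #|[set e | f e == x & ~~ sigma e]| in
               a <= b.+1 /\ b <= a.+1) /\
    (forall y, let a := #|[set e | g e == y & sigma e]| in
               let b := #|[set e | g e == y & ~~ sigma e]| in
               a <= b.+1 /\ b <= a.+1).
Proof.
have [p [pK fp p_fix]] := fibre_pairing f.
have [q [qK gq q_fix]] := fibre_pairing g.
have [sigma sigmaP] := colour_involutions pK qK.
exists sigma; split.
  by apply: (balanced_of_pairing pK fp p_fix) => e; case: (sigmaP e).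
by apply: (balanced_of_pairing qK gq q_fix) => e; case: (sigmaP e).
Qed.

(** * Joins in the incidence graph *)

(** [h] is the indicator of a set of edges, viewed as a chain with coefficients in
    the field with two elements; its boundary records the parity of the degrees. *)
Definition boundary (Block Omega : finType) (h : Block -> Omega -> bool)
    (v : Block + Omega) : bool :=
  match v with
  | inl B => \big[addb/false]_l h B l
  | inr l => \big[addb/false]_B h B l
  end.

Lemma boundaryD (Block Omega : finType) (h k : Block -> Omega -> bool) v :
  boundary (fun B l => h B l (+) k B l) v = boundary h v (+) boundary k v.
Proof. by case: v => x; rewrite /= big_split. Qed.

Lemma big_addb_sum (I : finType) (b : I -> bool) :
  \big[addb/false]_i b i = odd (\sum_i b i).
Proof.
rewrite (big_morph odd oddD (erefl : odd 0 = false)).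
by apply: eq_bigr => i _; rewrite oddb.
Qed.

Lemma big_addb_pred1 (I : finType) (i : I) (b : I -> bool) :
  \big[addb/false]_j ((j == i) && b j) = b i.
Proof.
rewrite (bigD1 i) //= eqxx big1 ?addbF // => j /negPf -> //.
Qed.

Lemma incidence_connect_sym (Block Omega : finType) (A : Block -> {set Omega}) :
  connect_sym (incidence_rel A).
Proof. by apply: sym_connect_sym => -[x|x] [y|y]. Qed.

Lemma edge_boundary (Block Omega : finType) (B : Block) (l : Omega) w :
  boundary (fun C k => (C == B) && (k == l)) w = (w == inl B) (+) (w == inr l).
Proof.
case: w => [C|k]; rewrite /= ?addbF.
  under eq_bigr do rewrite andbC.
  by rewrite big_addb_pred1.
by rewrite big_addb_pred1.
Qed.

Lemma path_join (Block Omega : finType) (A : Block -> {set Omega})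
    (u v : Block + Omega) :
    connect (incidence_rel A) u v ->
  exists h : Block -> Omega -> bool,
    (forall B l, h B l -> l \in A B) /\
    (forall w, boundary h w = (w == u) (+) (w == v)).
Proof.
case/connectP => p; elim: p u => [|u' p IHp] u /=.
  move=> _ ->; exists (fun _ _ => false); split=> // w.
  by rewrite addbb; case: w => x; rewrite /= big1.
case/andP => uu' path_p def_v; have [h [hA hP]] := IHp u' path_p def_v.
have [B [l [lB uu'P]]] : exists B l, l \in A B /\
    forall w, (w == inl B) (+) (w == inr l) = (w == u) (+) (w == u').
  case: u u' uu' {path_p def_v IHp hP} => [B|l] [C|k] //= lB.
    by exists B, k.
  by exists C, l; split=> // w; rewrite addbC.
exists (fun C k => ((C == B) && (k == l)) (+) h C k); split=> [C k | w].
  by case: eqP => [-> | _ /hA //]; case: eqP => [-> | _ /hA].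
by rewrite boundaryD edge_boundary hP uu'P -addbA addKb.
Qed.

(** The sum of the paths from the columns to the roots of their components has
    boundary the sum of all columns, the contributions at the roots cancelling
    because components have evenly many columns. *)
Lemma odd_join (Block Omega : finType) (A : Block -> {set Omega}) :
    (forall C : {set Block + Omega},
       C \in components (incidence_rel A) -> ~~ odd #|columns C|) ->
  exists h : Block -> Omega -> bool,
    [/\ forall B l, h B l -> l \in A B,
        forall B, boundary h (inl B) = false
      & forall l, boundary h (inr l) = true].
Proof.
move=> even_comp; set e := incidence_rel A.
have e_sym : connect_sym e by apply: incidence_connect_sym.
have [h hP] : exists h : Omega -> Block -> Omega -> bool, forall k,
    (forall B l, h k B l -> l \in A B) /\
    (forall w, boundary (h k) w = (w == inr k) (+) (w == fingraph.root e (inr k))).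
  exact: (fin_all_exists (fun k => path_join (connect_root e (inr k)))).
have even_root v : \big[addb/false]_k (v == fingraph.root e (inr k)) = false.
  case: (eqVneq (fingraph.root e v) v) => [root_v | root_v]; last first.
    rewrite big1 // => k _; apply: contraNF root_v => /eqP ->.
    by rewrite root_root.
  pose C := [set y in [set: Block + Omega] | connect e v y].
  rewrite big_addb_sum -(negPf (even_comp C _)).
    rewrite -sum1_card [in RHS]big_mkcond /=; congr (odd _); apply: eq_bigr => k _.
    rewrite !inE /= -{1}root_v (root_connect e_sym).
    by case: connect.
  by apply/imsetP; exists v.
pose H B l := \big[addb/false]_k h k B l.
have HP v : boundary H v = \big[addb/false]_k (v == inr k).
  transitivity (\big[addb/false]_k boundary (h k) v).
    by case: v => x; rewrite /= exchange_big.
  under eq_bigr do rewrite (hP _).2.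
  by rewrite big_split /= even_root addbF.
exists H; split=> [B l | B | l].
- apply: contraTT => lB; rewrite /H big1 // => k _.
  by apply: contraNF lB; apply: (hP k).1.
- by rewrite HP big1.
- rewrite HP -[RHS](big_addb_pred1 l xpredT).
  by apply: eq_bigr => k _; rewrite andbT eq_sym.
Qed.

Lemma card_set_sum (T : finType) (a : pred T) : #|[set x | a x]| = \sum_x a x.
Proof.
rewrite -sum1_card big_mkcond; apply: eq_bigr => x _.
by rewrite inE; case: (a x).
Qed.

Lemma card_set_transport (I E : finType) (g : I -> E) (a : pred E) :
    injective g -> (forall e, a e -> e \in codom g) ->
  #|[set e | a e]| = \sum_i a (g i).
Proof.
move=> g_inj a_codom; rewrite -card_set_sum -(card_imset _ g_inj).
apply: eq_card => e; rewrite inE; apply/idP/imsetP => [ae | [i]].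
  by have /codomP[i def_e] := a_codom e ae; exists i; rewrite // inE -def_e.
by rewrite inE => ? ->.
Qed.

(** Even degree at a block turns a discrepancy at most one into zero, and odd
    degree at a column turns it into exactly one. *)
Lemma signed_join (Block Omega : finType) (h : Block -> Omega -> bool) :
    (forall B, boundary h (inl B) = false) ->
    (forall l, boundary h (inr l) = true) ->
  exists s : Block -> Omega -> bool,
    (forall B, #|[set l | h B l & s B l]| = #|[set l | h B l & ~~ s B l]|) /\
    (forall l, let p := \sum_B (h B l && s B l : nat) in
               let n := \sum_B (h B l && ~~ s B l : nat) in
               p = n.+1 \/ n = p.+1).
Proof.
move=> hB hl.
(* Recording [h] in the key separates the edges of the join from the other
   pairs, so that fibres over [true] contain edges of the join only. *)
have [s [sB sl]] := balanced_colouring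
  (fun e : Block * Omega => (e.1, h e.1 e.2)) (fun e => (e.2, h e.1 e.2)).
have cardB (tau : pred (Block * Omega)) B :
    #|[set e : Block * Omega | ((e.1, h e.1 e.2) == (B, true)) && tau e]|
    = \sum_l (h B l && tau (B, l) : nat).
  rewrite (@card_set_transport _ _ (fun l => (B, l))) => [|? ? [] //|[C l]].
    by apply: eq_bigr => l _; rewrite -pair_eqE /= eqxx eqb_id.
  by rewrite -pair_eqE => /andP[/andP[/eqP /= -> _] _]; apply: codom_f.
have cardl (tau : pred (Block * Omega)) l :
    #|[set e : Block * Omega | ((e.2, h e.1 e.2) == (l, true)) && tau e]|
    = \sum_B (h B l && tau (B, l) : nat).
  rewrite (@card_set_transport _ _ (fun B => (B, l))) => [|? ? [] //|[B k]].
    by apply: eq_bigr => B _; rewrite -pair_eqE /= eqxx eqb_id.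
  rewrite -pair_eqE => /andP[/andP[/eqP /= -> _] _].
  exact: (codom_f (fun C => (C, l))).
have split_sum (I : finType) (b c : pred I) :
    \sum_i b i = \sum_i (b i && c i : nat) + \sum_i (b i && ~~ c i : nat).
  by rewrite -big_split; apply: eq_bigr => i _; case: (b i); case: (c i).
exists (fun B l => s (B, l)); split=> [B | l].
  rewrite !card_set_sum; move: (sB (B, true)); rewrite /= !cardB.
  move: (hB B); rewrite /= big_addb_sum (split_sum _ _ (fun l => s (B, l))); lia.
move: (sl (l, true)); rewrite /= !cardl.
by move: (hl l); rewrite /= big_addb_sum (split_sum _ _ (fun B => s (B, l))); lia.
Qed.

(** * Realising a signed block by half-size subsets *)

Lemma connected_of_hub (T Omega : finType) (F : T -> {set Omega}) (t2 : T) :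
  (forall t, F t :&: F t2 != set0) -> intersection_connected F.
Proof.
move=> meet_hub s t.
have to_hub u : connect (intersection_rel F) u t2.
  case: (eqVneq u t2) => [-> // | neq_u].
  by apply: connect1; rewrite /intersection_rel neq_u meet_hub.
have F_sym : connect_sym (intersection_rel F).
  by apply: sym_connect_sym => u v; rewrite /intersection_rel eq_sym setIC.
by apply: connect_trans (to_hub s) _; rewrite F_sym.
Qed.

(** [M] consists of the columns used at every index; [tau] gives the exceptional
    index of a signed column, the only one that selects a column of [P] and the
    only one that omits a column of [N]. *)
Definition selection (T Omega : finType) (M P N : {set Omega})
    (tau : Omega -> T) (t : T) : {set Omega} :=
  [set l | [|| l \in M, (l \in P) && (tau l == t) | (l \in N) && (tau l != t)]].

Lemma selection_degree (T Omega : finType) (M P N : {set Omega})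
    (tau : Omega -> T) (l : Omega) :
    [disjoint P & N] -> [disjoint M & P :|: N] ->
  \sum_t (l \in selection M P N tau t : nat) + (l \in N)
    = (l \in P) + (l \in M :|: N) * #|T|.
Proof.
move=> PN MPN.
have := disjointFr PN (x := l); have := disjointFr MPN (x := l).
under eq_bigr do rewrite inE.
rewrite !inE.
have one : \sum_t (tau l == t : nat) = 1.
  rewrite (bigD1 (tau l)) //= eqxx big1 // => t /negPf; rewrite eq_sym => -> //.
have rest : \sum_t (tau l != t : nat) + 1 = #|T|.
  by rewrite -one -big_split -sum1_card; apply: eq_bigr => t _; case: eqP.
case: (l \in M) => [/(_ isT)/norP[/negPf-> /negPf->] _ | _] /=.
  by rewrite sum1_card mul1n addn0.
case: (l \in P) => [/(_ isT)-> | _] /=.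
  under eq_bigr do rewrite orbF.
  by rewrite one.
case: (l \in N) => /=; first by rewrite rest mul1n.
by rewrite big1.
Qed.

(** At index [t] as many columns of [P] are gained as columns of [N] are lost. *)
Lemma card_selection (T Omega : finType) (M P N : {set Omega})
    (tau : Omega -> T) (t : T) :
    [disjoint P & N] -> [disjoint M & P :|: N] ->
    #|[set l in P | tau l == t]| = #|[set l in N | tau l == t]| ->
  #|selection M P N tau t| = #|M| + #|N|.
Proof.
move=> PN MPN card_t.
have <- : #|[set l in P | tau l == t]| + #|[set l in N | tau l != t]| = #|N|.
  rewrite card_t -(cardsID [set l | tau l == t] N); congr (_ + _).
    by apply: eq_card => l; rewrite !inE.
  by apply: eq_card => l; rewrite !inE andbC.
have -> : selection M P N tau t
    = M :|: ([set l in P | tau l == t] :|: [set l in N | tau l != t]).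
  by apply/setP => l; rewrite !inE.
have disj0 (X Y : {set Omega}) : [disjoint X & Y] -> #|X :|: Y| = #|X| + #|Y|.
  by move=> XY; rewrite cardsU (disjoint_setI0 XY) cards0 subn0.
rewrite !disj0 //.
  by apply: disjointWl (disjointWr _ PN); apply/subsetP => l; rewrite inE => /andP[].
apply: disjointWr MPN; apply: setUSS; apply/subsetP => l; by rewrite inE => /andP[].
Qed.

(** The set at an index [t2] that is exceptional for no column contains [M] and
    [N].  It meets every other set, either in [M] or in a column of [N] that the
    other set does not omit. *)
Lemma selection_connected (T Omega : finType) (M P N : {set Omega})
    (tau : Omega -> T) (t2 : T) :
    (forall l, tau l != t2) -> 1 < #|M| + #|N| ->
    (1 < #|N| -> forall t, exists2 l, l \in N & tau l != t) ->
  intersection_connected (selection M P N tau).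
Proof.
move=> tau_t2 large N_free; apply: (@connected_of_hub _ _ _ t2) => t.
case: (set_0Vmem M) => [M0 | [l lM]]; last first.
  by apply/set0Pn; exists l; rewrite !inE lM.
rewrite M0 cards0 add0n in large; have [l lN lt] := N_free large t.
by apply/set0Pn; exists l; rewrite !inE lN lt tau_t2 !orbT.
Qed.

(** Hence whatever holds for selections holds for their complements, with the
    roles of [P] and [N] exchanged. *)
Lemma selection_compl (T Omega : finType) (A M P N : {set Omega})
    (tau : Omega -> T) (t : T) :
    P \subset A -> N \subset A -> [disjoint P & N] -> [disjoint M & P :|: N] ->
  A :\: selection M P N tau t = selection (A :\: (M :|: (P :|: N))) N P tau t.
Proof.
move=> PA NA PN MPN; apply/setP => l; rewrite !inE.
have /negbT := pred0P PN l; have /negbT := pred0P MPN l; rewrite /= !inE.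
have /implyP := subsetP PA l; have /implyP := subsetP NA l.
by case: (l \in M); case: (l \in P); case: (l \in N); case: (l \in A);
  case: (tau l == t).
Qed.

Lemma two_indices_card (T Omega : finType) (t0 t1 : T) (P N Q : {set Omega}) t :
    t0 != t1 -> #|P| = #|N| -> #|P :&: Q| = #|N :&: Q| ->
  #|[set l in P | (if l \in Q then t0 else t1) == t]|
    = #|[set l in N | (if l \in Q then t0 else t1) == t]|.
Proof.
move=> t01 PN PNQ.
have sizeE (X : {set Omega}) : #|[set l in X | (if l \in Q then t0 else t1) == t]|
    = (t0 == t) * #|X :&: Q| + (t1 == t) * (#|X| - #|X :&: Q|).
  rewrite -cardsD.
  have [<- | /negPf t0t] := eqVneq t0 t.
    rewrite eq_sym (negPf t01) mul1n addn0; apply: eq_card => l; rewrite !inE.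
    by case: (l \in Q); rewrite ?eqxx // eq_sym (negPf t01).
  have [<- | /negPf t1t] := eqVneq t1 t.
    rewrite mul1n; apply: eq_card => l; rewrite !inE.
    by case: (l \in Q); rewrite ?eqxx ?(negPf t01) ?andbT ?andbF.
  apply: eq_card0 => l; rewrite !inE.
  by case: (l \in Q); rewrite ?t0t ?t1t andbF.
by rewrite !sizeE PN PNQ.
Qed.

(** The index [t0] is given to one column of [P] and one of [N], and [t1] to all
    others: both values then occur on each side as soon as it has two columns.
    The conditions on [D] ask that a column of [D] be absent at [t0].  They are
    met by picking outside [D] in [P], and inside [D] in [N] whenever possible.
    If [P] lies inside [D], it has at most one column, and [t1] serves for
    all. *)
Lemma exceptional_indices (T Omega : finType) (t0 t1 : T) (A D P N : {set Omega}) :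
    t0 != t1 -> #|A :&: D| <= 1 -> P \subset A -> N \subset A ->
    [disjoint P & N] -> #|P| = #|N| ->
  exists tau : Omega -> T,
    [/\ forall l, tau l = t0 \/ tau l = t1,
        forall t, #|[set l in P | tau l == t]| = #|[set l in N | tau l == t]|,
        forall l, l \in D -> (l \in P -> tau l = t1) /\ (l \in N -> tau l = t0),
        1 < #|P| -> forall t, exists2 l, l \in P & tau l != t
      & 1 < #|N| -> forall t, exists2 l, l \in N & tau l != t].
Proof.
move=> t01 /card_le1_eqP AD1 /subsetP PA /subsetP NA PN cardPN.
have D1 k l : k \in A -> k \in D -> l \in A -> l \in D -> k = l.
  by move=> kA kD lA lD; apply: AD1; rewrite inE ?kA ?lA.
(* [Q] is the set of columns that receive the index [t0]. *)
suff [Q [PNQ QD PQ]] : exists Q : {set Omega},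
    [/\ #|P :&: Q| = #|N :&: Q|,
        forall l, l \in D -> (l \in P -> l \notin Q) /\ (l \in N -> l \in Q)
      & 1 < #|P| -> #|P :&: Q| = 1].
  exists (fun l => if l \in Q then t0 else t1).
  have spread (X : {set Omega}) : 1 < #|X| -> #|X :&: Q| = 1 ->
      forall t, exists2 l, l \in X & (if l \in Q then t0 else t1) != t.
    move=> X1 XQ t; have [def_t | t_t0] := eqVneq t t0.
      have /card_gt0P[l] : 0 < #|X :\: Q| by rewrite cardsD XQ subn_gt0.
      rewrite inE => /andP[/negPf lQ lX]; exists l => //.
      by rewrite lQ def_t eq_sym.
    have /card_gt0P[l] : 0 < #|X :&: Q| by rewrite XQ.
    by rewrite inE => /andP[lX lQ]; exists l; rewrite // lQ eq_sym.
  split=> [l | t | l lD | P1 | N1].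
  - by case: ifP; [left | right].
  - exact: two_indices_card.
  - by have [nQ Q'] := QD l lD; split=> [/nQ/negPf -> | /Q' ->].
  - by apply: spread => //; apply: PQ.
  - by apply: spread => //; rewrite -PNQ PQ // cardPN.
case: (set_0Vmem (P :\: D)) => [P_D | [p]].
  have {}P_D p : p \in P -> p \in D.
    move=> pP; apply: contraT => pD.
    by have := in_set0 p; rewrite -P_D inE pD pP.
  exists set0; split=> [| l lD | P1].
  - by rewrite !setI0.
  - split=> [_ | lN]; first by rewrite inE.
    have /card_gt0P[p pP] : 0 < #|P| by rewrite cardPN; apply/card_gt0P; exists l.
    have pl : p = l by exact: D1 (PA p pP) (P_D p pP) (NA l lN) lD.
    by have := disjointFr PN pP; rewrite pl lN.
  - have /card_gt1P[x [y [xP yP /eqP[]]]] := P1.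
    by apply: D1; [apply: PA | apply: P_D | apply: PA | apply: P_D].
rewrite inE => /andP[pD pP].
have [n nN nD] : exists2 n, n \in N & forall l, l \in N -> l \in D -> l = n.
  case: (set_0Vmem (N :&: D)) => [N_D | [n]].
    have /card_gt0P[n nN] : 0 < #|N| by rewrite -cardPN; apply/card_gt0P; exists p.
    exists n => // l lN lD; have := in_set0 l.
    by rewrite -N_D inE lN lD.
  rewrite inE => /andP[nN nD]; exists n => // l lN lD.
  by apply: D1 => //; apply: NA.
have nP := disjointFl PN nN; have pN := disjointFr PN pP.
have PQ : P :&: [set p; n] = [set p].
  apply/setP => l; rewrite !inE; case: eqP => [-> | _]; first by rewrite pP.
  by case: eqP => [-> | _]; rewrite ?nP ?andbF.
have NQ : N :&: [set p; n] = [set n].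
  apply/setP => l; rewrite !inE orbC; case: eqP => [-> | _]; first by rewrite nN.
  by case: eqP => [-> | _]; rewrite ?pN ?andbF.
exists [set p; n]; rewrite PQ NQ !cards1; split=> // l lD.
split=> [lP | lN]; last by rewrite (nD l lN lD) !inE eqxx orbT.
rewrite !inE; apply/norP; split; first by apply: contraNneq pD => <-.
by apply: contraFneq nP => <-.
Qed.

Lemma block_selection (T Omega : finType) (t0 : T) (A D P N : {set Omega}) :
    2 < #|T| -> #|A :&: D| <= 1 -> P \subset A -> N \subset A ->
    [disjoint P & N] -> #|P| = #|N| ->
  exists J : T -> {set Omega},
    [/\ forall t, J t \subset A /\ #|J t| = #|A| %/ 2,
        exists K : {set Omega}, forall l,
          \sum_t (l \in J t : nat) + (l \in N) = (l \in P) + (l \in K) * #|T|,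
        forall l, l \in D -> l \notin J t0,
        (forall t, 1 < #|J t|) -> intersection_connected J
      & (forall t, 1 < #|A :\: J t|) -> intersection_connected (fun t => A :\: J t)].
Proof.
move=> T3 AD1 PA NA PN cardPN.
have /card_gt0P[t1] : 0 < #|[set~ t0]| by rewrite cardsC1; lia.
rewrite !inE eq_sym => t01.
have /card_gt0P[t2] : 0 < #|~: [set t0; t1]|.
  by rewrite cardsCs setCK cards2 t01; lia.
rewrite !inE => /norP[t20 t21].
have [tau [tau01 tau_card tauD P_spread N_spread]] :=
  exceptional_indices t01 AD1 PA NA PN cardPN.
have tau2 l : tau l != t2 by case: (tau01 l) => ->; rewrite eq_sym.
have cardA : #|A| = #|A :\: (P :|: N)| + (#|P| + #|N|).
  rewrite -(cardsID (P :|: N) A) addnC; congr (_ + _).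
  rewrite (setIidPr _) ?subUset ?PA //.
  by rewrite cardsU (disjoint_setI0 PN) cards0 subn0.
pose z := #|A :\: (P :|: N)|.
(* Rounding down leaves room to avoid the possible unsigned column of [D]: if
   there is one, then half of [z], rounded down, is at most [z - 1]. *)
have /card_geqP[s [uniq_s size_s sS]] : z %/ 2 <= #|A :\: (P :|: N) :\: D|.
  have := cardsID D (A :\: (P :|: N)); rewrite -/z.
  have : #|(A :\: (P :|: N)) :&: D| <= 1.
    by apply: leq_trans AD1; apply/subset_leq_card/setSI/subsetDl.
  by lia.
pose M := [set l in s].
have MP l : l \in M -> [/\ l \in A, l \notin P, l \notin N & l \notin D].
  by rewrite inE => /sS; rewrite !inE negb_or -!andbA => /and4P[].
have MPN : [disjoint M & P :|: N].
  apply/pred0P => l /=; apply/negP => /andP[/MP[_ lP lN _]].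
  by rewrite inE (negPf lP) (negPf lN).
have cardM : #|M| = z %/ 2 by rewrite cardsE (card_uniqP uniq_s).
clearbody M.
have cardJ t : #|selection M P N tau t| = #|A| %/ 2.
  by rewrite card_selection // cardM cardA -/z cardPN; lia.
have JA t : selection M P N tau t \subset A.
  apply/subsetP => l; rewrite inE => /or3P[/MP[] // | /andP[lP _] | /andP[lN _]].
    exact: (subsetP PA).
  exact: (subsetP NA).
have compl t := selection_compl tau t PA NA PN MPN.
exists (selection M P N tau); split=> [t | | l lD | large | large].
- by [].
- by exists (M :|: N) => l; apply: selection_degree.
- have [tauP tauN] := tauD l lD.
  rewrite inE; apply/or3P => -[/MP[_ _ _] | /andP[/tauP-> ] | /andP[/tauN->]].
  + by rewrite lD.
  + by rewrite eq_sym (negPf t01).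
  + by rewrite eqxx.
- refine (selection_connected P tau2 _ N_spread).
  by rewrite -(card_selection PN MPN (tau_card t0)).
- have conn : intersection_connected (selection (A :\: (M :|: (P :|: N))) N P tau).
    refine (selection_connected N tau2 _ P_spread).
    have := large t0; rewrite compl card_selection //.
    + by rewrite disjoint_sym.
    + rewrite disjoints_subset; apply/subsetP => l; rewrite !inE.
      by case: (l \in M); case: (l \in P); case: (l \in N).
  move=> u v; have := conn u v; congr (is_true _); apply: eq_connect => x y.
  by rewrite /intersection_rel !compl.
Qed.

(** * The equivalence *)

Lemma odd_of_unit_residue (m k : nat) : ~~ odd m ->
    (Posz k = 1 %[mod Posz m])%Z \/ (Posz k = - 1 %[mod Posz m])%Z ->
  odd k.
Proof.
move=> m_even; have -> : Posz m = (Posz m./2 * 2)%R by lia.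
by case=> /eqP; rewrite eqz_mod_dvd => /dvdzP[q]; rewrite GRing.mulrA => qP; lia.
Qed.

(** [k] is a column total, [p] and [n] count the positive and negative edges at
    the column, and [c] the blocks in which it is negative or always used. *)
Lemma unit_residue_of_balance (m k p n c : nat) :
    k + n = p + c * m -> p = n.+1 \/ n = p.+1 ->
  (Posz k = 1 %[mod Posz m])%Z \/ (Posz k = - 1 %[mod Posz m])%Z.
Proof.
by move=> bal [] def; [left | right]; apply/eqP; rewrite eqz_mod_dvd;
  apply/dvdzP; exists (Posz c); lia.
Qed.

(** Double counting of the incidences in a component between its columns and the
    sets of its blocks: a block contributes a multiple of the even number [#|T|],
    since its sets lie inside the component. *)
Lemma component_even (T Omega Block : finType)
    (A : Block -> {set Omega}) (b : Block -> nat)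
    (J : Block -> T -> {set Omega}) :
    ~~ odd #|T| ->
    (forall B t, J B t \subset A B /\ #|J B t| = b B) ->
    (forall l, odd (\sum_B \sum_t (l \in J B t : nat))) ->
  forall C : {set Block + Omega},
    C \in components (incidence_rel A) -> ~~ odd #|columns C|.
Proof.
move=> T_even J_row J_col C /imsetP[v _ def_C].
have closed B l : l \in A B -> (inl B \in C) = (inr l \in C).
  move=> lB; rewrite def_C !inE /=.
  by apply: same_connect_r; [exact: incidence_connect_sym | exact: connect1].
have -> : odd #|columns C|
    = odd (\sum_(l in columns C) \sum_B \sum_t (l \in J B t : nat)).
  rewrite -sum1_card !(big_morph odd oddD (erefl : odd 0 = false)).
  by apply: eq_bigr => l _; rewrite J_col.
rewrite exchange_big (eq_bigr (fun B => #|T| * ((inl B \in C) * b B))).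
  by rewrite -big_distrr oddM (negPf T_even).
move=> B _; rewrite exchange_big -sum_nat_const /=; apply: eq_bigr => t _.
have [JA <-] := J_row B t.
transitivity (\sum_l (inl B \in C) * (l \in J B t)).
  rewrite big_mkcond; apply: eq_bigr => l _; rewrite inE.
  case lJ: (l \in J B t); last by case: ifP; rewrite muln0.
  by rewrite (closed B l (subsetP JA l lJ)); case: (_ \in C).
by rewrite -big_distrr -sum1_card [in RHS]big_mkcond.
Qed.

Theorem proposition4p1 (m : nat) (m_ge4 : 4 <= m) (m_even : ~~ odd m)
    (Omega Block : finType) (A : Block -> {set Omega})
    (A_ge2 : forall B : Block, 2 <= #|A B|)
    (Odist : {set Omega})
    (A_dist : forall B : Block, #|A B :&: Odist| <= 1) :
  (forall C : {set Block + Omega},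
      C \in components (incidence_rel A) -> ~~ odd #|columns C|)
  <->
  (exists J : Block -> 'Z_m -> {set Omega},
    [/\ forall (B : Block) (t : 'Z_m),
          J B t \subset A B /\ #|J B t| = #|A B| %/ 2,
        forall l : Omega,
          let total : nat := \sum_(B : Block) \sum_(t : 'Z_m) (l \in J B t : nat) in
          (Posz total = 1 %[mod Posz m])%Z \/ (Posz total = - 1 %[mod Posz m])%Z,
        forall (l : Omega) (B : Block),
          l \in Odist -> l \notin J B 0%R
      & forall B : Block,
          ((forall t : 'Z_m, 2 <= #|J B t|) ->
             intersection_connected (fun t : 'Z_m => J B t)) /\
          ((forall t : 'Z_m, 2 <= #|A B :\: J B t|) ->
             intersection_connected (fun t : 'Z_m => A B :\: J B t))]).
Proof.
have card_Zm : #|'Z_m| = m by rewrite card_ord Zp_cast //; apply: leq_trans m_ge4.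
split=> [even_comp | [J [J_row J_col _ _]]]; last first.
  apply: (@component_even _ _ _ A (fun B => #|A B| %/ 2) J) => // [|l].
    by rewrite card_Zm.
  exact: odd_of_unit_residue m_even (J_col l).
have [h [hA h_block h_col]] := odd_join even_comp.
have [s [s_block s_col]] := signed_join h_block h_col.
pose P B := [set l | h B l & s B l]; pose N B := [set l | h B l & ~~ s B l].
have PA B : P B \subset A B.
  by apply/subsetP => l; rewrite inE => /andP[/hA].
have NA B : N B \subset A B.
  by apply/subsetP => l; rewrite inE => /andP[/hA].
have PN B : [disjoint P B & N B].
  by apply/pred0P => l; rewrite /= !inE; case: (h B l); case: (s B l).
have Zm_gt2 : 2 < #|'Z_m| by rewrite card_Zm; apply: leq_trans m_ge4.
have [J J_rows] := fin_all_exists (fun B =>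
  block_selection 0%R Zm_gt2 (A_dist B) (PA B) (NA B) (PN B) (s_block B)).
exists J; split=> [B t | l | l B lD | B].
- by have [/(_ t)] := J_rows B.
- have /fin_all_exists[K KP] : forall B, exists K : {set Omega}, forall k,
      \sum_t (k \in J B t : nat) + (k \in N B) = (k \in P B) + (k \in K) * m.
    move=> B; have [_ [K KP] _ _ _] := J_rows B.
    by exists K => k; rewrite KP card_Zm.
  have /= := s_col l.
  apply: (@unit_residue_of_balance _ _ _ _ (\sum_B (l \in K B))).
  rewrite big_distrl -!big_split /=; apply: eq_bigr => B _.
  by have := KP B l; rewrite !inE.
- by have [_ _ /(_ l lD)] := J_rows B.
- by have [_ _ _ JC AJC] := J_rows B; split.
Qed.
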